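(* Let $r\in\{4,5\}$, let $n\ge r-1$ and $k\ge\binom{r}{2}$ be integers. Then $$\mathrm{ex}_k(n, K_r)\le\max\left\{\left(\binom{r}{2}-1\right)\binom{n}{2},\ k\cdot t_{r-1}(n)\right\}.$$
   Context: $K_r$ denotes the complete graph on $r$ vertices. $t_{r-1}(n)$ is the number of edges of the Turán graph $T_{r-1}(n)$, the complete $(r-1)$-partite graph on $n$ vertices whose part sizes differ by at most one. Let $F$ be a fixed graph with edge set $\{e_1,\dots,e_m\}$ and $k\ge m$. A multiset $\mathcal{G}_n^k=\{G_1,\dots,G_k\}$ of graphs on vertex set $[n]=\{1,\dots,n\}$ is called rainbow $F$-free if there is no set of distinct indices $\{i_1,\dots,i_m\}\subseteq[k]$ with $e_j\in G_{i_j}$ for every $j\in[m]$ (for every copy of $F$ in $K_n$, i.e. every labelling of the edges of every copy). Write $|\mathcal{G}_n^k|=\sum_{i=1}^k|E(G_i)|$. The rainbow Turán number $\mathrm{ex}_k(n,F)$ is the maximum of $|\mathcal{G}_n^k|$ over all rainbow $F$-free multisets $\mathcal{G}_n^k$ of $k$ graphs on $[n]$. *)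

(* Defs.v *)
From HB Require Import structures.
From mathcomp Require Import all_boot.

Set Implicit Arguments.
Unset Strict Implicit.
Unset Printing Implicit Defensive.

Record sgraph (V : finType) := SGraph {
  edges : {set {set V}};
  edgesP : [forall e in edges, #|e| == 2]
}.

HB.instance Definition _ (V : finType) := [isSub for @edges V].
HB.instance Definition _ (V : finType) := [Finite of sgraph V by <:].

Lemma complete_subproof (V : finType) :
  [forall e in [set e : {set V} | #|e| == 2], #|e| == 2].
Proof. by apply/forall_inP => e; rewrite inE. Qed.

Definition complete (V : finType) : sgraph V := SGraph (complete_subproof V).

Notation "''K_' r" := (complete 'I_r) (at level 8, r at level 2).

(* The part of residue class a among the s parts; turan_part_balanced and
   turan_partition below check that the parts partition the vertices and that
   their sizes differ by at most one. *)
Definition turan_part (s n a : nat) : {set 'I_n} := [set x : 'I_n | x %% s == a].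

Definition turan_edges (s n : nat) : {set {set 'I_n}} :=
  [set [set x; y] | x in 'I_n, y in [pred y : 'I_n | x %% s != y %% s]].

Lemma turan_subproof (s n : nat) : [forall e in turan_edges s n, #|e| == 2].
Proof.
apply/forall_inP => e /imset2P [x y _]; rewrite inE => xy ->.
by rewrite cards2; case: (eqVneq x y) xy => [->|//]; rewrite eqxx.
Qed.

Definition turan (s n : nat) : sgraph 'I_n := SGraph (turan_subproof s n).

Definition turan_number (s n : nat) : nat := #|edges (turan s n)|.

Lemma turan_partition (s n : nat) (x : 'I_n) :
  0 < s -> exists! a : 'I_s, x \in turan_part s n a.
Proof.
move=> s0; exists (Ordinal (ltn_pmod x s0)); split; first by rewrite inE.
by move=> a; rewrite inE => /eqP xa; apply: val_inj.
Qed.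

Lemma turan_adjE (s n : nat) (x y : 'I_n) :
  ([set x; y] \in edges (turan s n)) = (x %% s != y %% s).
Proof.
apply/imset2P/idP => [[u v _]|xy]; last by exists x y; rewrite ?inE.
rewrite inE => uv E; apply: contraNneq uv => xy.
have part z : z \in [set x; y] -> z %% s = x %% s.
  by rewrite !inE => /orP[] /eqP ->.
by rewrite !part ?E ?set21 ?set22.
Qed.

Lemma turan_part_balanced (s n a b : nat) :
  a < s -> b < s -> #|turan_part s n a| <= #|turan_part s n b|.+1.
Proof.
move=> lt_as lt_bs; have s0 : 0 < s by exact: leq_ltn_trans lt_as.
case: n => [|n]; first by rewrite (leq_trans (max_card _)) ?card_ord.
pose q (x : 'I_n.+1) : 'I_n.+1 := inord ((x %/ s).-1 * s + b).
pose A := [set x in turan_part s n.+1 a | 0 < x %/ s].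
have leA : #|turan_part s n.+1 a| <= #|A|.+1.
  rewrite -(cardsID [set x : 'I_n.+1 | 0 < x %/ s]) -[#|A|.+1]addn1 leq_add //.
    by apply: subset_leq_card; apply/subsetP => x; rewrite !inE.
  apply/card_le1P => x; rewrite !inE -leqNgt leqn0 => /andP[/eqP x0 /eqP xa] y.
  rewrite !inE -leqNgt leqn0 -val_eqE /=; apply/andP/eqP => [[/eqP y0 /eqP ya]|->].
    by rewrite (divn_eq y s) (divn_eq x s) x0 y0 xa ya.
  by rewrite x0 xa !eqxx.
apply: leq_trans leA _; rewrite ltnS.
have qE x : x \in A -> q x = (x %/ s).-1 * s + b :> nat.
  rewrite !inE => /andP[_ xs]; rewrite inordK //.
  apply: leq_trans (ltn_ord x); rewrite ltnS {2}(divn_eq x s).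
  rewrite -{2}(prednK xs) mulSn addnAC addnC leq_add2r.
  exact: leq_trans (ltnW lt_bs) (leq_addr _ _).
rewrite -(card_in_imset (f := q)).
  apply: subset_leq_card; apply/subsetP => y /imsetP[x xA ->].
  by rewrite inE qE // modnMDl modn_small.
move=> x y xA yA /(congr1 val) /=; rewrite !qE // => /addIn /eqP.
rewrite eqn_pmul2r // => /eqP E; apply: val_inj => /=.
move: xA yA; rewrite !inE => /andP[/eqP xa x0] /andP[/eqP ya y0].
by rewrite (divn_eq x s) (divn_eq y s) xa ya -(prednK x0) -(prednK y0) E.
Qed.

(* A multiset of k graphs on n vertices is encoded by an enumeration of its
   members, with repetitions allowed. *)
Definition gfamily (k n : nat) := {ffun 'I_k -> sgraph 'I_n}.

Definition family_size (k n : nat) (G : gfamily k n) : nat :=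
  \sum_(i < k) #|edges (G i)|.

(* f embeds F in the complete graph on the n vertices and c injectively picks
   the member of the family supplying each edge. *)
Definition rainbow_free (V : finType) (F : sgraph V) (k n : nat)
    (G : gfamily k n) : bool :=
  ~~ [exists f : {ffun V -> 'I_n},
      exists c : {ffun {e : {set V} | e \in edges F} -> 'I_k},
      [&& injectiveb f, injectiveb c &
        [forall e : {e : {set V} | e \in edges F}, f @: val e \in edges (G (c e))]]].

Definition rainbow_ex (k n : nat) (V : finType) (F : sgraph V) : nat :=
  \max_(G : gfamily k n | rainbow_free F G) family_size G.

(* Main.v *)
(** Give each edge e of K_n the weight w(e) = number of members of the family
containing e. If the increasingly sorted weights w_1 <= ... <= w_m of the edges of
a copy of K_r satisfied w_j >= j for all j, greedy choice of colours would make
that copy rainbow; so in every K_r some j has more than j edges of weight <= j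
(0 <= j < m). Only this condition on w is used to bound the total weight, by
induction on the number of vertices.

If all weights are less than m, the first term of the maximum is a bound.
Otherwise, starting from an edge of weight >= m, grow a clique A that keeps few
light edges (at most g_|A|(j) edges of weight <= j, for suitable thresholds g_i),
until no vertex can be added. Maximality forces each outside vertex to have several
light edges to A, hence to send little weight to A, and removing A lowers the
weight by no more than the claimed bound drops. Since |A| < r, only
finitely many thresholds have to be checked. *)

Require Import Defs.
From mathcomp Require Import all_boot zify.

Set Implicit Arguments.
Unset Strict Implicit.
Unset Printing Implicit Defensive.

(** * Thresholds for the number of small entries *)

(** For [g = iota 0 m] and a list of length [m], the sorted entries dominate 1, ..., m: this is the
    condition for greedy colouring. *)
Definition sparse (g s : seq nat) : bool :=
  all (fun j => count (leq^~ j) s <= nth 0 g j) (iota 0 (size g)).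

Lemma sparseP g s :
  reflect (forall j, j < size g -> count (leq^~ j) s <= nth 0 g j) (sparse g s).
Proof.
apply: (iffP allP) => h j; last by rewrite mem_iota => /h.
by move=> jg; apply: h; rewrite mem_iota.
Qed.

Lemma sumn_count_leq (j k : nat) (s : seq nat) : all (leq^~ k) s ->
  sumn s <= count (leq^~ j) s * j + (size s - count (leq^~ j) s) * k.
Proof.
elim: s => //= x s IH /andP[xk /IH].
have := count_size (leq^~ j) s; case: leqP => xj /=; nia.
Qed.

(** At a violated threshold [j], the excess over what [xs] may contribute must come from the [c]
    entries of [ys] that are at most [j]; the other entries of [ys] are at most [k]. *)
Lemma sparse_extend (k : nat) (g h xs ys : seq nat) :
  all (leq^~ k) ys -> size g = size h -> sparse g xs -> ~~ sparse h (xs ++ ys) ->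
  exists j c, [/\ j < size h, c <= size ys, nth 0 h j < nth 0 g j + c
                & sumn ys <= c * j + (size ys - c) * k].
Proof.
move=> ysk gh /sparseP xsP /allPn[j]; rewrite mem_iota /= -ltnNge count_cat => jh hj.
exists j, (count (leq^~ j) ys); split=> //; first exact: count_size.
  by apply: leq_trans hj _; rewrite leq_add2r xsP ?gh.
exact: sumn_count_leq.
Qed.

(** * Distinct representatives by greedy choice *)

(** Choosing from left to right, the set at index [i] has more elements than the at most [i] already
    taken. *)
Lemma distinct_representatives_ord (E : eqType) (C : finType) (c0 : C)
    (L : E -> {set C}) (e0 : E) (s : seq E) :
  (forall i, i < size s -> i < #|L (nth e0 s i)|) ->
  exists c : E -> C, {in s, forall e, c e \in L e} /\ {in s &, injective c}.
Proof.
elim/last_ind: s => [|s e IH] hs; first by exists (fun=> c0).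
have [i si|c [cL cI]] := IH.
  by have := hs i; rewrite size_rcons nth_rcons si; apply; apply: ltnW.
have := hs (size s); rewrite size_rcons nth_rcons ltnn eqxx => /(_ (leqnn _)) eL.
(* Entries of [s] may repeat; a repeated entry keeps its representative. *)
have [es|es] := boolP (e \in s).
  exists c; split=> [x|x y]; rewrite !mem_rcons !inE.
    by case/predU1P=> [->|]; exact: cL.
  by case/predU1P=> [->|xs] /predU1P[->|ys]; exact: cI.
have /subsetPn[d dL ds] : ~~ (L e \subset [seq c x | x <- s]).
  apply/negP => /subset_leq_card; rewrite leqNgt => /negP; apply.
  by apply: leq_ltn_trans eL; rewrite -(size_map c); exact: card_size.
have cd x : x \in s -> c x <> d.
  by move=> xs cxd; case/negP: ds; rewrite -cxd map_f.
exists (fun x => if x == e then d else c x); split=> [x|x y].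
  by rewrite mem_rcons inE; case: eqP => [->|_] //=; exact: cL.
rewrite !mem_rcons !inE; case: eqP => [->|_] /=; case: eqP => [->|_] //= xs ys.
- by move=> dE; case: (cd y).
- by move=> dE; case: (cd x).
- exact: cI.
Qed.

(** After sorting by size the greedy choice applies: if the set at index [i] had at most [i]
    elements, so would the [i + 1] first sets, against sparsity. *)
Lemma distinct_representatives (E : eqType) (C : finType) (c0 : C)
    (L : E -> {set C}) (s : seq E) :
  sparse (iota 0 (size s)) [seq #|L e| | e <- s] ->
  exists c : E -> C, {in s, forall e, c e \in L e} /\ {in s &, injective c}.
Proof.
case: s => [|e0 s0]; first by exists (fun=> c0).
move: (e0 :: s0) => s /sparseP sP.
pose le e e' := #|L e| <= #|L e'|.
have le_trans : transitive le by move=> x y z; exact: leq_trans.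
have le_total : total le by move=> x y; exact: leq_total.
pose t := sort le s.
have ts : perm_eq t s by rewrite perm_sort.
have [i it|c [cL cI]] := @distinct_representatives_ord E C c0 L e0 t; last first.
  by exists c; split=> [x xs|x y xs ys]; [apply: cL | apply: cI];
    rewrite (perm_mem ts).
have ss := perm_size ts.
rewrite ltnNge; apply/negP => Li.
have := sP i; rewrite size_iota -ss => /(_ it); rewrite nth_iota -?ss // add0n.
rewrite leqNgt => /negP; apply.
rewrite -(permP (perm_map _ ts)) -(cat_take_drop i.+1 t) map_cat count_cat.
apply: leq_trans (leq_addr _ _).
have: all (leq^~ i) [seq #|L e| | e <- take i.+1 t].
  rewrite all_map; apply/(all_nthP e0) => j; rewrite size_takel // => ji.
  rewrite /= nth_take //; apply: leq_trans Li.
  have le_refl : reflexive le by move=> x; exact: leqnn.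
  apply: (sorted_leq_nth le_trans le_refl e0 (sort_sorted le_total s)) => //.
  by rewrite inE; exact: leq_trans it.
by rewrite all_count => /eqP ->; rewrite size_map size_takel.
Qed.

(** * From sparse weights to rainbow cliques *)

(** Edges at the new vertex come last, so enlarging a clique appends to its list of weights, as in
    [sparse_extend]. *)
Fixpoint pairs (V : finType) (s : seq V) : seq {set V} :=
  if s is v :: s' then pairs s' ++ [seq [set v; x] | x <- s'] else [::].

Lemma size_pairs (V : finType) (s : seq V) : size (pairs s) = 'C(size s, 2).
Proof.
by elim: s => //= v s IH; rewrite size_cat size_map IH binS bin1.
Qed.

Lemma mem_pairs (V : finType) (s : seq V) x y :
  x \in s -> y \in s -> x != y -> [set x; y] \in pairs s.
Proof.
elim: s => //= v s IH; rewrite !inE mem_cat.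
case/predU1P=> [->|xs] /predU1P[->|ys]; rewrite ?eqxx // => xy.
- by rewrite (map_f (fun z => [set v; z]) ys) orbT.
- by rewrite setUC (map_f (fun z => [set v; z]) xs) orbT.
- by rewrite IH.
Qed.

(** Otherwise distinct representatives of the sets of available colours would make the clique on [s]
    rainbow. *)
Lemma rainbow_free_not_sparse (r k n : nat) (G : gfamily k n) (s : seq 'I_n) :
  0 < k -> rainbow_free 'K_r G -> uniq s -> size s = r ->
  ~~ sparse (iota 0 'C(r, 2))
       [seq #|[set i | e \in edges (G i)]| | e <- pairs s].
Proof.
move=> k0 /negP Gfree us ss; apply/negP => sp; apply: Gfree.
rewrite -ss -size_pairs in sp.
have [c [cL cI]] := distinct_representatives (Ordinal k0) sp.
pose f (i : 'I_r) := tnth (in_tuple s) (cast_ord (esym ss) i).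
have fI : injective f.
  by move=> i j /(tuple_uniqP (in_tuple s) us) /cast_ord_inj.
have fP (e : {e : {set 'I_r} | e \in edges 'K_r}) : f @: val e \in pairs s.
  case: e => e /=; rewrite inE => /cards2P[a [b [ab ->]]].
  rewrite imsetU !imset_set1; apply: mem_pairs; rewrite ?(inj_eq fI) //; exact: mem_tnth.
apply/existsP; exists [ffun i => f i].
have fE (e : {set 'I_r}) : [ffun i => f i] @: e = f @: e.
  by apply: eq_imset => i; rewrite ffunE.
apply/existsP; exists [ffun e : {e | e \in edges 'K_r} => c (f @: val e)]; apply/and3P; split.
- by apply/injectiveP => i j; rewrite !ffunE => /fI.
- apply/injectiveP => e e'; rewrite !ffunE => /(cI _ _ (fP e) (fP e')) /(imset_inj fI).
  exact: val_inj.
- by apply/forallP => e; rewrite ffunE fE; have := cL _ (fP e); rewrite inE.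
Qed.

(** * Counting edges of Turán graphs *)

Lemma sum_pairs_card (V : finType) (G : sgraph V) :
  \sum_x \sum_y ([set x; y] \in edges G) = 2 * #|edges G|.
Proof.
rewrite pair_big /= -big_mkcond /= -sum1_card big_distrr /=.
rewrite (partition_big (fun p : V * V => [set p.1; p.2]) (mem (edges G))) //=.
apply: eq_bigr => e eG; have /forall_inP/(_ _ eG)/cards2P[a [b [ab eE]]] := edgesP G.
rewrite muln1 sum1_card.
have -> : 2 = #|[set (a, b); (b, a)]|.
  by rewrite cards2 xpair_eqE (negPf ab).
apply: eq_card => -[x y]; rewrite !inE !xpair_eqE unfold_in /=.
apply/andP/orP => [[_ /eqP xye]|].
  have := set21 x y; have := set22 x y; rewrite xye eE !inE.
  have xy : x != y.
    apply/eqP => xy; have : #|e| = 2 by rewrite eE cards2 ab.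
    by rewrite -xye xy setUid cards1.
  by case/orP=> /eqP yE /orP[]/eqP xE; move: xy; rewrite xE yE ?eqxx // => _; [right|left].
by case=> /andP[/eqP-> /eqP->]; rewrite ?[[set b; a]]setUC -eE eG.
Qed.

(* Vertex i of the Turán graph has i - i %/ s neighbours among 0, ..., i - 1. *)
Fixpoint turan_count (s n : nat) : nat :=
  if n is i.+1 then turan_count s i + (i - i %/ s) else 0.

(** Each full block of [s] consecutive integers contributes one; the final partial block contributes
    when it reaches the residue. *)
Lemma count_residue (s n m : nat) : 0 < s ->
  \sum_(i < n) (i %% s == m %% s) = n %/ s + (m %% s < n %% s).
Proof.
move=> s0; elim: n => [|n IH]; first by rewrite big_ord0 div0n mod0n.
rewrite big_ord_recr /= IH divnS // modnS.
have ms := ltn_pmod m s0.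
have [sn|sn] /= := boolP (s %| n.+1); last by rewrite (ltnS (m %% s)); case: ltngtP; lia.
have -> : n %% s = s.-1.
  by have [->|s1] := eqVneq s 1; [rewrite modn1 | rewrite -[n]/(n.+1.-1) modn_pred // sn].
case: ltngtP; lia.
Qed.

Lemma sum_residue_neq (s n : nat) : 0 < s ->
  \sum_(i < n) \sum_(j < n) (i %% s != j %% s) = 2 * turan_count s n.
Proof.
move=> s0; elim: n => [|n IH]; first by rewrite big_ord0.
have E : \sum_(i < n) (i %% s != n %% s) = n - n %/ s.
  have := count_residue n n s0; rewrite ltnn addn0 => <-.
  have : \sum_(i < n) ((i %% s != n %% s) + (i %% s == n %% s)) = n.
    by rewrite (eq_bigr (fun=> 1)) ?sum1_card ?card_ord // => i _; case: eqP.
  rewrite big_split /=; lia.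
rewrite big_ord_recr /= big_ord_recr /= eqxx addn0.
rewrite (eq_bigr (fun i : 'I_n =>
  \sum_(j < n) (i %% s != j %% s) + (i %% s != n %% s))); last first.
  by move=> i _; rewrite big_ord_recr.
rewrite big_split /= IH E.
rewrite (eq_bigr (fun i : 'I_n => (i %% s != n %% s) : nat)) ?E; first by lia.
by move=> i _; rewrite eq_sym.
Qed.

(** The identities measure the loss when a clique is removed; the density bound limits the [k] for
    which the complete-graph term can dominate. *)
Lemma turan_count3 (n : nat) :
  [/\ turan_count 3 (n + 2) = turan_count 3 n + (2 * n + 1 - n %/ 3 - n.+1 %/ 3),
      turan_count 3 (n + 3) = turan_count 3 n + (2 * n + 3)
    & 2 * 'C(n, 2) <= 3 * turan_count 3 n].
Proof.
rewrite addn2 addn3; split; [by rewrite /=; lia | by rewrite /=; lia |].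
suff: 2 * 'C(n, 2) + n %/ 3 <= 3 * turan_count 3 n by lia.
elim: n => // n IH; rewrite binS bin1 /=; lia.
Qed.

Lemma turan_count4 (n : nat) :
  [/\ turan_count 4 (n + 2) = turan_count 4 n + (2 * n + 1 - n %/ 4 - n.+1 %/ 4),
      turan_count 4 (n + 3) = turan_count 4 n + (3 * n + 3 - n %/ 4 - n.+1 %/ 4 - n.+2 %/ 4),
      turan_count 4 (n + 4) = turan_count 4 n + (3 * n + 6)
    & 3 * 'C(n, 2) <= 4 * turan_count 4 n].
Proof.
rewrite addn2 addn3 addn4.
split; [by rewrite /=; lia | by rewrite /=; lia | by rewrite /=; lia |].
suff: 3 * 'C(n, 2) + n %/ 4 <= 4 * turan_count 4 n by lia.
elim: n => // n IH; rewrite binS bin1 /=; lia.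
Qed.

(** * Total weight and removal of a clique *)

(* Each pair is counted twice. *)
Definition weight (T : finType) (w : {set T} -> nat) (S : {set T}) : nat :=
  \sum_(x in S) \sum_(y in S) w [set x; y].

Lemma weightD1 (T : finType) (w : {set T} -> nat) (S : {set T}) (v : T) :
  (forall x, w [set x] = 0) -> v \in S ->
  weight w S = weight w (S :\ v) + 2 * \sum_(y in S :\ v) w [set v; y].
Proof.
move=> w1 vS; rewrite /weight (big_setD1 v vS) /= (big_setD1 v vS) /= setUid w1 add0n.
have -> : \sum_(x in S :\ v) \sum_(y in S) w [set x; y] =
    \sum_(x in S :\ v) (w [set v; x] + \sum_(y in S :\ v) w [set x; y]).
  by apply: eq_bigr => x _; rewrite (big_setD1 v vS) /= [[set x; v]]setUC.
by rewrite big_split /=; lia.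
Qed.

Lemma weight_setD (T : finType) (w : {set T} -> nat) (S : {set T}) (A : seq T) :
  (forall x, w [set x] = 0) -> uniq A -> {subset A <= S} ->
  weight w S = weight w (S :\: [set x in A]) + 2 * sumn [seq w e | e <- pairs A]
    + 2 * \sum_(v in S :\: [set x in A]) sumn [seq w [set v; x] | x <- A].
Proof.
move=> w1; elim: A => [_ _|a A IH /= /andP[aA uA] AS].
  have -> : [set x in [::]] = set0 :> {set T} by apply/setP => x; rewrite !inE.
  by rewrite setD0 /= big1 ?muln0 ?addn0.
have aS : a \in S by apply: AS; rewrite mem_head.
have aSA : a \in S :\: [set x in A] by rewrite !inE aA.
rewrite IH //; last by move=> x xA; apply: AS; rewrite inE xA orbT.
have -> : S :\: [set x in a :: A] = (S :\: [set x in A]) :\ a.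
  by apply/setP => x; rewrite !inE negb_or andbA.
move: (S :\: [set x in A]) aSA => D aD.
rewrite (weightD1 w1 aD) (big_setD1 a aD) /= big_split /= map_cat sumn_cat.
have -> : [seq w e | e <- [seq [set a; x] | x <- A]] = [seq w [set a; x] | x <- A].
  by rewrite -map_comp.
have -> : \sum_(i in D :\ a) w [set i; a] =
    \sum_(i in D :\ a) w [set a; i].
  by apply: eq_bigr => i _; rewrite setUC.
lia.
Qed.

Lemma weight_setD_le (T : finType) (w : {set T} -> nat) (S : {set T}) (A : seq T)
    (a : nat) :
  (forall x, w [set x] = 0) -> uniq A -> {subset A <= S} ->
  (forall v, v \in S -> v \notin A -> sumn [seq w [set v; x] | x <- A] <= a) ->
  #|S :\: [set x in A]| + size A = #|S| /\
  weight w S <= weight w (S :\: [set x in A])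
    + 2 * (sumn [seq w e | e <- pairs A] + a * #|S :\: [set x in A]|).
Proof.
move=> w1 uA AS aP; split.
  have <- : #|[set x in A]| = size A by rewrite cardsE; exact/card_uniqP.
  have AsubS : [set x in A] \subset S by apply/subsetP => x; rewrite inE => /AS.
  by rewrite -[RHS](cardsID [set x in A]) (setIidPr AsubS) addnC.
rewrite (weight_setD w1 uA AS) mulnDr addnA leq_add2l leq_mul2l /= mulnC -sum_nat_const.
by apply: leq_sum => v; rewrite !inE => /andP[vA vS]; exact: aP.
Qed.

Lemma weight_le (T : finType) (w : {set T} -> nat) (S : {set T}) (a : nat) :
  (forall x, w [set x] = 0) ->
  {in S &, forall x y, x != y -> w [set x; y] <= a} ->
  weight w S <= 2 * (a * 'C(#|S|, 2)).
Proof.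
move=> w1 wa.
have -> : 2 * (a * 'C(#|S|, 2)) = #|S| * (#|S|.-1 * a).
  by rewrite mulnCA -mul_bin_diag bin1 mulnCA [a * _]mulnC.
rewrite /weight -sum_nat_const; apply: leq_sum => x xS.
rewrite (big_setD1 x xS) /= setUid w1 add0n (cardsD1 x S) xS /= -sum_nat_const.
by apply: leq_sum => y; rewrite !inE => /andP[yx yS]; apply: wa => //; rewrite eq_sym.
Qed.

(** * Maximal sparse cliques and the induction *)

Lemma sumn_le_size (k : nat) (s : seq nat) : all (leq^~ k) s -> sumn s <= size s * k.
Proof. by elim: s => //= x s IH /andP[xk /IH]; lia. Qed.

Lemma maximal_seq (T : finType) (Q : pred (seq T)) (r : nat) (A : seq T) :
  (forall B, size B = r -> ~~ Q B) -> size A < r -> Q A ->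
  exists B, [/\ Q B, size A <= size B < r & forall v, ~~ Q (v :: B)].
Proof.
move=> Qr; have [m] := ubnP (r - size A); elim: m A => // m IH A rA Ar QA.
have [/forallP nQ|] := boolP [forall v, ~~ Q (v :: A)]; first by exists A; rewrite leqnn.
rewrite negb_forall => /existsP[v]; rewrite negbK => QvA.
have vAr : size (v :: A) < r.
  by rewrite ltn_neqAle Ar andbT; apply: contraTneq QvA => /Qr.
have [|B [QB /andP[AB Br] nQ]] := IH _ _ vAr QvA; first by rewrite /=; lia.
by exists B; rewrite (ltnW AB).
Qed.

(* The entry at j of the i-th list bounds the number of pairs of weight at most
   j in a clique of size i. *)
Definition sparse_in (T : finType) (w : {set T} -> nat) (g : seq (seq nat))
    (S : {set T}) (A : seq T) : bool :=
  [&& uniq A, all (mem S) A & sparse (nth [::] g (size A)) [seq w e | e <- pairs A]].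

(** Since the thresholds for two vertices are all zero, an edge is sparse exactly when its weight
    exceeds [m]; any such edge grows to a maximal sparse clique. *)
Lemma sparse_in_or_le (T : finType) (w : {set T} -> nat) (g : seq (seq nat))
    (m r : nat) (S : {set T}) :
  (forall x, w [set x] = 0) -> 2 < r -> nth [::] g 2 = nseq m.+1 0 ->
  (forall s, uniq s -> size s = r ->
     ~~ sparse (nth [::] g r) [seq w e | e <- pairs s]) ->
  weight w S <= 2 * (m * 'C(#|S|, 2)) \/
  exists A, [/\ 2 <= size A < r, sparse_in w g S A, uniq A, {subset A <= S} &
    forall v, v \in S -> v \notin A ->
      ~~ sparse (nth [::] g (size A).+1) [seq w e | e <- pairs (v :: A)]].
Proof.
move=> w1 r2 g2 wr.
have gr B : size B = r -> ~~ sparse_in w g S B.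
  by move=> sB; apply/and3P => -[uB _]; rewrite sB; apply/negP/wr.
have [/forall_inP Sm|] :=
    boolP [forall x in S, forall y in S, (x != y) ==> (w [set x; y] <= m)].
  left; apply: weight_le => // x y xS yS xy.
  by have /forall_inP/(_ y yS) := Sm x xS; rewrite xy.
rewrite negb_forall_in => /exists_inP[x xS].
rewrite negb_forall_in => /exists_inP[y yS]; rewrite negb_imply -ltnNge => /andP[xy mxy].
right; have [|A [QA sA nQ]] := maximal_seq (A := [:: x; y]) gr r2.
  rewrite /sparse_in /= inE xy xS yS /= g2; apply/sparseP => j.
  rewrite size_nseq => jm; rewrite nth_nseq if_same /=.
  by rewrite [w _ <= j]leqNgt (leq_trans jm mxy).
have /and3P[uA /allP AS _] := QA.
exists A; split=> // v vS vA; apply: contra (nQ v) => spv.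
by rewrite /sparse_in /= vA uA vS spv !andbT /=; exact/allP.
Qed.

(** Here [f] is the claimed bound, [c] bounds the weight inside the maximal clique and [a] the
    weight it receives from each outside vertex; the growth of [f] pays for removing the clique. *)
Lemma weight_bound (T : finType) (w : {set T} -> nat) (k m r : nat)
    (g : seq (seq nat)) (f : nat -> nat) :
  (forall x, w [set x] = 0) -> (forall e, w e <= k) ->
  2 < r -> nth [::] g 2 = nseq m.+1 0 ->
  (forall s, uniq s -> size s = r ->
     ~~ sparse (nth [::] g r) [seq w e | e <- pairs s]) ->
  (forall n, m * 'C(n, 2) <= f n) ->
  (forall i xs, 2 <= i < r -> size xs = 'C(i, 2) -> all (leq^~ k) xs ->
     sparse (nth [::] g i) xs ->
     exists c a, [/\ sumn xs <= c,
       forall ys, size ys = i -> all (leq^~ k) ys ->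
         ~~ sparse (nth [::] g i.+1) (xs ++ ys) -> sumn ys <= a
     & forall n, f n + (c + a * n) <= f (n + i)]) ->
  forall S : {set T}, weight w S <= 2 * f #|S|.
Proof.
move=> w1 wk r2 g2 wr fm step S; have [b] := ubnP #|S|; elim: b S => // b IH S Sb.
have wall (s : seq {set T}) : all (leq^~ k) [seq w e | e <- s].
  by apply/allP => _ /mapP[e _ ->]; exact: wk.
have [flat|[A [sA /and3P[_ _ gA] uA AS nA]]] := sparse_in_or_le S w1 r2 g2 wr.
  by apply: leq_trans flat _; rewrite leq_mul2l fm.
have [|c [a [wA out fS]]] := step _ _ sA _ (wall _) gA.
  by rewrite size_map size_pairs.
have aP v : v \in S -> v \notin A -> sumn [seq w [set v; x] | x <- A] <= a.
  move=> vS vA; apply: out; first by rewrite size_map.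
    by apply/allP => _ /mapP[x _ ->]; exact: wk.
  by have := nA v vS vA; rewrite /= map_cat -map_comp.
have [SA wS] := weight_setD_le w1 uA AS aP.
have Sb' : #|S :\: [set x in A]| < b by case/andP: sA; lia.
have := IH _ Sb'; have := fS #|S :\: [set x in A]|; rewrite SA.
by move: #|S :\: _| wS => n; lia.
Qed.

(** * The case of $K_4$ *)

(** A dominant Turán term absorbs the step by itself; otherwise the density bound forces [k <= 7]
    and the complete-graph term absorbs it. *)
Lemma maxn_turan3_step (k N i c a : nat) : 6 <= k ->
  [\/ [/\ i = 2, c = k & a = k.+1] | [/\ i = 3, c = 3 * k & a = 2 * k]] ->
  maxn (5 * 'C(N, 2)) (k * turan_count 3 N) + (c + a * N) <=
  maxn (5 * 'C(N + i, 2)) (k * turan_count 3 (N + i)).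
Proof.
move=> k6 ica; have [t2 t3 tC] := turan_count3 N.
have b2 : 'C(N + 2, 2) = 'C(N, 2) + 2 * N + 1 by rewrite addn2 !binS !bin1 !bin0; lia.
have b3 : 'C(N + 3, 2) = 'C(N, 2) + 3 * N + 3 by rewrite addn3 !binS !bin1 !bin0; lia.
have step : k * turan_count 3 N + (c + a * N) <= k * turan_count 3 (N + i).
  case: ica => -[-> -> ->]; last by rewrite t3; nia.
  rewrite t2; have : N <= 6 * (N - N %/ 3 - N.+1 %/ 3) by lia.
  (* The surplus [d] of the Turán increment over [N + 1], multiplied by [k], pays for the extra 1 in
     [a = k + 1]. *)
  set d := N - _ - _ => Nd.
  have Nkd : N <= k * d by rewrite (leq_trans Nd) // leq_mul2r k6 orbT.
  have -> : 2 * N + 1 - N %/ 3 - N.+1 %/ 3 = N.+1 + d by rewrite /d; lia.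
  lia.
have [tb|bt] := leqP (5 * 'C(N, 2)) (k * turan_count 3 N).
  by apply: leq_trans step _; exact: leq_maxr.
have N1 : 0 < N by case: N bt {step t2 t3 tC b2 b3} => [|//]; rewrite muln0.
apply: leq_trans (leq_maxl _ _).
have [k6'|k7] : k = 6 \/ k = 7 by nia.
  by case: ica => -[-> -> ->]; rewrite ?b2 ?b3; lia.
(* For [k = 7] and [i = 3] the gain 15N + 15 must cover 14N + 21. For N at most 5 the Turán term
   dominates, by computation. *)
have N6 : 5 < N.
  rewrite ltnNge; apply: contraTN bt => N6; rewrite k7 -leqNgt.
  by clear -N6; do 6!(case: N N6 => [//|N N6]).
by case: ica => -[-> -> ->]; rewrite ?b2 ?b3; lia.
Qed.

Lemma weight_bound4 (T : finType) (w : {set T} -> nat) (k : nat) (S : {set T}) :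
  6 <= k -> (forall x, w [set x] = 0) -> (forall e, w e <= k) ->
  (forall s, uniq s -> size s = 4 -> ~~ sparse (iota 0 6) [seq w e | e <- pairs s]) ->
  weight w S <= 2 * maxn (5 * 'C(#|S|, 2)) (k * turan_count 3 #|S|).
Proof.
move=> k6 w1 wk w4.
(* The worst outside bounds are k + 1 for [i = 2] (at j = 1) and 2k for [i = 3] (at j = 0); there k
   + 6 at j = 3 and 12 at j = 4 fit because [6 <= k]. *)
pose g := [:: [::]; [::]; nseq 6 0; [:: 0; 0; 1; 2; 2; 2]; iota 0 6].
pose f n := maxn (5 * 'C(n, 2)) (k * turan_count 3 n).
apply: (weight_bound (g := g) (f := f) w1 wk _ _ w4) => // [n|]; first exact: leq_maxl.
move=> [|[|[|[|i]]]] xs // _ sxs xsk gxs.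
- exists k, k.+1; split; first by have := sumn_le_size xsk; rewrite sxs mul1n.
    move=> ys sys ysk /(sparse_extend ysk _ gxs)[]// j [c []]; rewrite sys.
    do 6?[case: j => [|j]] => //; do 3?[case: c => [|c]] => //=; lia.
  by move=> n; apply: maxn_turan3_step => //; left.
- exists (3 * k), (2 * k); split; first by have := sumn_le_size xsk; rewrite sxs.
    move=> ys sys ysk /(sparse_extend ysk _ gxs)[]// j [c []]; rewrite sys.
    do 6?[case: j => [|j]] => //; do 4?[case: c => [|c]] => //=; lia.
  by move=> n; apply: maxn_turan3_step => //; right.
Qed.

(** * The case of $K_5$ *)

Lemma maxn_turan4_step (k N i c a : nat) : 10 <= k ->
  [\/ [/\ i = 2, c = k & a = k.+2], [/\ i = 3, c = 3 * k & a = (2 * k).+1]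
    | [/\ i = 4, c = 6 * k & a = 3 * k]] ->
  maxn (9 * 'C(N, 2)) (k * turan_count 4 N) + (c + a * N) <=
  maxn (9 * 'C(N + i, 2)) (k * turan_count 4 (N + i)).
Proof.
move=> k10 ica; have [t2 t3 t4 tC] := turan_count4 N.
have b2 : 'C(N + 2, 2) = 'C(N, 2) + 2 * N + 1 by rewrite addn2 !binS !bin1 !bin0; lia.
have b3 : 'C(N + 3, 2) = 'C(N, 2) + 3 * N + 3 by rewrite addn3 !binS !bin1 !bin0; lia.
have b4 : 'C(N + 4, 2) = 'C(N, 2) + 4 * N + 6 by rewrite addn4 !binS !bin1 !bin0; lia.
have step : k * turan_count 4 N + (c + a * N) <= k * turan_count 4 (N + i).
  case: ica => -[-> -> ->]; last by rewrite t4; lia.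
    rewrite t2; have : 2 * N <= 10 * (N - N %/ 4 - N.+1 %/ 4) by lia.
    set d := N - _ - _ => Nd.
    have Nkd : 2 * N <= k * d by rewrite (leq_trans Nd) // leq_mul2r k10 orbT.
    have -> : 2 * N + 1 - N %/ 4 - N.+1 %/ 4 = N.+1 + d by rewrite /d; lia.
    lia.
  rewrite t3; have : N <= 10 * (N - N %/ 4 - N.+1 %/ 4 - N.+2 %/ 4) by lia.
  set d := N - _ - _ - _ => Nd.
  have Nkd : N <= k * d by rewrite (leq_trans Nd) // leq_mul2r k10 orbT.
  have -> : 3 * N + 3 - N %/ 4 - N.+1 %/ 4 - N.+2 %/ 4 = 2 * N + 3 + d.
    by rewrite /d; lia.
  lia.
have [tb|bt] := leqP (9 * 'C(N, 2)) (k * turan_count 4 N).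
  by apply: leq_trans step _; exact: leq_maxr.
have N1 : 0 < N by case: N bt {step t2 t3 t4 tC b2 b3 b4} => [|//]; rewrite muln0.
apply: leq_trans (leq_maxl _ _).
have [k10'|k11] : k = 10 \/ k = 11 by nia.
  by case: ica => -[-> -> ->]; rewrite ?b2 ?b3 ?b4; lia.
(* For [k = 11] and [i = 4] the gain 36N + 54 must cover 33N + 66. *)
have N4 : 3 < N.
  rewrite ltnNge; apply: contraTN bt => N4; rewrite k11 -leqNgt.
  by clear -N4; do 4!(case: N N4 => [//|N N4]).
by case: ica => -[-> -> ->]; rewrite ?b2 ?b3 ?b4; lia.
Qed.

(* For k = 10, a 4-clique with five edges of weight <= 8 may receive 32 > 3k from
   an outside vertex, but then it has inner weight at most 50 < 6k. *)
Lemma maxn_turan4_step10 (N : nat) :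
  maxn (9 * 'C(N, 2)) (10 * turan_count 4 N) + (50 + 32 * N) <=
  maxn (9 * 'C(N + 4, 2)) (10 * turan_count 4 (N + 4)).
Proof.
have [_ _ t4 _] := turan_count4 N.
have b4 : 'C(N + 4, 2) = 'C(N, 2) + 4 * N + 6 by rewrite addn4 !binS !bin1 !bin0; lia.
(* The Turán gain 30N + 60 suffices up to N = 5; beyond that the complete-graph term dominates and
   gains 36N + 54. *)
have [N5|N5] := leqP N 5; first by rewrite t4 b4; lia.
suff: 10 * turan_count 4 N <= 9 * 'C(N, 2) by rewrite t4 b4; lia.
elim: N N5 {t4 b4} => // N IH; rewrite ltnS leq_eqVlt => /predU1P[<- //|N5].
by have := IH N5; rewrite binS bin1 /=; lia.
Qed.

Lemma weight_bound5 (T : finType) (w : {set T} -> nat) (k : nat) (S : {set T}) :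
  10 <= k -> (forall x, w [set x] = 0) -> (forall e, w e <= k) ->
  (forall s, uniq s -> size s = 5 -> ~~ sparse (iota 0 10) [seq w e | e <- pairs s]) ->
  weight w S <= 2 * maxn (9 * 'C(#|S|, 2)) (k * turan_count 4 #|S|).
Proof.
move=> k10 w1 wk w5.
(* The worst outside bounds are k + 2 for [i = 2] (at j = 2) and 2k + 1 for [i = 3] (at j = 1). For
   [i = 4] the bound is 3k, except that for k = 10 the thresholds j = 7 and j = 8 allow 31 and
   32. *)
pose g := [:: [::]; [::]; nseq 10 0; [:: 0; 0; 0; 1; 2; 2; 2; 2; 2; 2];
  [:: 0; 0; 1; 2; 3; 4; 4; 5; 5; 5]; iota 0 10].
pose f n := maxn (9 * 'C(n, 2)) (k * turan_count 4 n).
apply: (weight_bound (g := g) (f := f) w1 wk _ _ w5) => // [n|]; first exact: leq_maxl.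
move=> [|[|[|[|[|i]]]]] xs // _ sxs xsk gxs.
- exists k, k.+2; split; first by have := sumn_le_size xsk; rewrite sxs mul1n.
    move=> ys sys ysk /(sparse_extend ysk _ gxs)[]// j [c []]; rewrite sys.
    do 10?[case: j => [|j]] => //; do 3?[case: c => [|c]] => //=; lia.
  by move=> n; apply: maxn_turan4_step => //; constructor 1.
- exists (3 * k), (2 * k).+1; split; first by have := sumn_le_size xsk; rewrite sxs.
    move=> ys sys ysk /(sparse_extend ysk _ gxs)[]// j [c []]; rewrite sys.
    do 10?[case: j => [|j]] => //; do 4?[case: c => [|c]] => //=; lia.
  by move=> n; apply: maxn_turan4_step => //; constructor 2.
have [x8|x8] := boolP ((10 < k) || (count (leq^~ 8) xs <= 4)).
  exists (6 * k), (3 * k); split; first by have := sumn_le_size xsk; rewrite sxs.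
    move=> ys sys ysk; case/orP: x8 => [k11|x8].
      move=> /(sparse_extend ysk _ gxs)[]// j [c []]; rewrite sys.
      do 10?[case: j => [|j]] => //; do 5?[case: c => [|c]] => //=; lia.
    (* At most four weights up to 8 means at most four up to 7: the bound at j = 7 drops to 28, and
       j = 8 would need five light edges to four vertices. *)
    have gxs' : sparse [:: 0; 0; 1; 2; 3; 4; 4; 4; 4; 5] xs.
      move: gxs => /=; rewrite /sparse /= => /and5P[-> -> -> ->].
      move=> /and5P[-> -> -> x7 /and3P[_ -> _]].
      rewrite x8 /= andbT; apply: leq_trans x8; apply: sub_count => x /=; lia.
    move=> /(sparse_extend ysk _ gxs')[]// j [c []]; rewrite sys.
    do 10?[case: j => [|j]] => //; do 5?[case: c => [|c]] => //=; lia.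
  by move=> n; apply: maxn_turan4_step => //; constructor 3.
have {x8} [k10' x8] : k = 10 /\ count (leq^~ 8) xs = 5.
  by move: x8 (sparseP _ _ gxs 8 isT) => /=; lia.
(* Five weights of at most 8 and one of at most 10 give 50; four light edges at j = 8 give 32. *)
exists 50, 32; split.
- by have := sumn_count_leq 8 xsk; rewrite sxs x8 k10'.
- move=> ys sys ysk /(sparse_extend ysk _ gxs)[]// j [c []]; rewrite sys.
  do 10?[case: j => [|j]] => //; do 5?[case: c => [|c]] => //=; lia.
- by move=> n; rewrite /f k10'; exact: maxn_turan4_step10.
Qed.

(** * Transfer to families of graphs *)

Lemma turan_number_count (s n : nat) : 0 < s -> turan_number s n = turan_count s n.
Proof.
move=> s0; apply/eqP; rewrite -(eqn_pmul2l (isT : 0 < 2)) -sum_residue_neq //.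
rewrite -sum_pairs_card; apply/eqP; apply: eq_bigr => x _; apply: eq_bigr => y _.
by rewrite turan_adjE.
Qed.

Lemma weight_family (k n : nat) (G : gfamily k n) :
  weight (fun e => #|[set i | e \in edges (G i)]|) setT = 2 * family_size G.
Proof.
rewrite /family_size big_distrr /=.
under [RHS]eq_bigr do rewrite -sum_pairs_card.
rewrite exchange_big /=; apply: eq_big => [x|x _]; first by rewrite inE.
rewrite exchange_big /=; apply: eq_big => [y|y _]; first by rewrite inE.
by rewrite -sum1_card [LHS]big_mkcond; apply: eq_bigr => i _; rewrite inE; case: ifP.
Qed.

Theorem theorem1p4 (r n k : nat) (hr : r = 4 \/ r = 5) (hn : r - 1 <= n)
    (hk : 'C(r, 2) <= k) :
  rainbow_ex k n 'K_r <=
    maxn (('C(r, 2) - 1) * 'C(n, 2)) (k * turan_number (r - 1) n).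
Proof.
apply/bigmax_leqP => G Gfree; rewrite -(leq_pmul2l (isT : 0 < 2)) -weight_family.
set w := fun e => _.
have k0 : 0 < k by apply: leq_trans hk; case: hr => ->.
have w1 x : w [set x] = 0.
  apply: eq_card0 => i; rewrite inE; apply: contraTF (edgesP (G i)) => xG.
  by apply/forall_inPn; exists [set x] => //; rewrite cards1.
have wk e : w e <= k by rewrite -[leqRHS]card_ord max_card.
have wr s := rainbow_free_not_sparse k0 Gfree (s := s).
rewrite turan_number_count; last by case: hr => ->.
case: hr hk wr => -> hk wr.
  by have := weight_bound4 setT hk w1 wk wr; rewrite cardsT card_ord.
by have := weight_bound5 setT hk w1 wk wr; rewrite cardsT card_ord.
Qed.
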